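(* Let $F \subseteq E$ be a field extension and let $\mathfrak{g}$ and $\mathfrak{h}$ be Lie algebras over $E$ which are conjugate over the subfield $F$. Then the underlying Lie algebras over $F$ are isomorphic as Lie algebras over $F$, i.e. $\mathfrak{g}_F \cong \mathfrak{h}_F$.
   Context: For a field extension $F \subseteq E$ and a Lie algebra $\mathfrak{g}$ over $E$, the underlying Lie algebra $\mathfrak{g}_F$ is $\mathfrak{g}$ regarded as a Lie algebra over $F$ by restricting the scalar multiplication to $F$. $\mathrm{Aut}(E,F)$ is the group of field automorphisms of $E$ that fix $F$ pointwise. For a field automorphism $\sigma$ of $E$, a map $\varphi: V \to W$ between $E$-vector spaces is $\sigma$-linear if $\varphi(\lambda v + \mu w) = \sigma(\lambda)\varphi(v) + \sigma(\mu)\varphi(w)$ for all $v,w \in V$, $\lambda,\mu \in E$. A $\sigma$-isomorphism between Lie algebras over $E$ is a bijective $\sigma$-linear map which preserves the Lie bracket. Two Lie algebras $\mathfrak{g}$ and $\mathfrak{h}$ over $E$ are conjugate over $F$ if there exist $\sigma \in \mathrm{Aut}(E,F)$ and a $\sigma$-isomorphism of Lie algebras $\mathfrak{g} \to \mathfrak{h}$. *)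

(* Defs.v *)
From HB Require Import structures.
From mathcomp Require Import all_boot all_algebra.

Set Implicit Arguments.
Unset Strict Implicit.
Unset Printing Implicit Defensive.

Import GRing.Theory.
Local Open Scope ring_scope.

HB.mixin Record Lmodule_isLieAlgebra (K : fieldType) (V : Type)
    of GRing.Lmodule K V := {
  lieb : V -> V -> V;
  lieb_linearl : forall y, linear (lieb^~ y);
  lieb_linearr : forall x, linear (lieb x);
  liebxx : forall x, lieb x x = 0;
  lieb_jacobi : forall x y z,
    lieb x (lieb y z) + lieb y (lieb z x) + lieb z (lieb x y) = 0
}.

(* No finiteness condition on the dimension. *)
#[short(type="lieAlgType")]
HB.structure Definition LieAlgebra (K : fieldType) :=
  {V of Lmodule_isLieAlgebra K V & GRing.Lmodule K V}.

(* A field extension is given by its embedding iota : F -> E, which is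
   automatically injective, so that F need not be literally a subset of E and
   the extension may be infinite.  The alias restr_scalars iota g is the type g
   itself, carrying only the structures obtained by restricting the scalars to
   F. *)
Definition restr_scalars (F E : fieldType) (iota : {rmorphism F -> E})
  (g : Type) : Type := g.

Section RestrictionOfScalars.
Variables (F E : fieldType) (iota : {rmorphism F -> E}).

Section Lmodule.
Variable V : lmodType E.

HB.instance Definition _ := GRing.Zmodule.on (restr_scalars iota V).

Definition restr_scale (a : F) (v : restr_scalars iota V) :
    restr_scalars iota V :=
  iota a *: (v : V).

Fact restr_scaleA a b v :
  restr_scale a (restr_scale b v) = restr_scale (a * b) v.
Proof. by rewrite /restr_scale scalerA rmorphM. Qed.

Fact restr_scale1 : left_id 1 restr_scale.
Proof. by move=> v; rewrite /restr_scale rmorph1 scale1r. Qed.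

Fact restr_scaleDr : right_distributive restr_scale +%R.
Proof. by move=> a u v; apply: scalerDr. Qed.

Fact restr_scaleDl v : {morph restr_scale^~ v : a b / a + b}.
Proof. by move=> a b; rewrite /restr_scale rmorphD scalerDl. Qed.

HB.instance Definition _ := GRing.Zmodule_isLmodule.Build F
  (restr_scalars iota V)
  restr_scaleA restr_scale1 restr_scaleDr restr_scaleDl.

End Lmodule.

Section Lie.
Variable g : lieAlgType E.

Definition restr_lieb : restr_scalars iota g -> restr_scalars iota g ->
  restr_scalars iota g := @lieb E g.

Fact restr_lieb_linearl y : linear (restr_lieb^~ y).
Proof. by move=> a u v; apply: lieb_linearl. Qed.

Fact restr_lieb_linearr x : linear (restr_lieb x).
Proof. by move=> a u v; apply: lieb_linearr. Qed.

Fact restr_liebxx x : restr_lieb x x = 0.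
Proof. exact: liebxx. Qed.

Fact restr_lieb_jacobi x y z :
  restr_lieb x (restr_lieb y z) + restr_lieb y (restr_lieb z x) +
  restr_lieb z (restr_lieb x y) = 0.
Proof. exact: lieb_jacobi. Qed.

HB.instance Definition _ := Lmodule_isLieAlgebra.Build F
  (restr_scalars iota g)
  restr_lieb_linearl restr_lieb_linearr restr_liebxx restr_lieb_jacobi.

End Lie.
End RestrictionOfScalars.

Definition lie_isomorphic (K : fieldType) (g h : lieAlgType K) : Prop :=
  exists phi : {linear g -> h},
    bijective phi /\ {morph phi : x y / lieb x y}.

Definition field_aut_over (F E : fieldType) (iota : {rmorphism F -> E})
    (sigma : {rmorphism E -> E}) : Prop :=
  bijective sigma /\ forall a : F, sigma (iota a) = iota a.

Definition semilinear_map (E : fieldType) (sigma : E -> E) (V W : lmodType E)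
    (phi : V -> W) : Prop :=
  forall (a b : E) (v w : V),
    phi (a *: v + b *: w) = sigma a *: phi v + sigma b *: phi w.

Definition sigma_isomorphism (E : fieldType) (sigma : E -> E)
    (g h : lieAlgType E) (phi : g -> h) : Prop :=
  [/\ bijective phi, semilinear_map sigma phi &
      {morph phi : x y / lieb x y}].

Definition conjugate_over (F E : fieldType) (iota : {rmorphism F -> E})
    (g h : lieAlgType E) : Prop :=
  exists sigma : {rmorphism E -> E},
    field_aut_over iota sigma /\
    exists phi : g -> h, sigma_isomorphism sigma phi.

(* Main.v *)
From HB Require Import structures.
Require Import Defs.
From mathcomp Require Import all_boot all_algebra.

Import GRing.Theory.
Local Open Scope ring_scope.

(** The conjugating map [phi] is itself the isomorphism over [F]: [sigma] fixes the image of [iota],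
    so [sigma]-linearity becomes ordinary linearity on restricted scalars, while bijectivity and
    bracket preservation involve no scalars. *)

Lemma semilinear_restr_linear (F E : fieldType) (iota : {rmorphism F -> E})
    (sigma : {rmorphism E -> E}) (V W : lmodType E) (phi : V -> W) :
  (forall a : F, sigma (iota a) = iota a) -> semilinear_map sigma phi ->
  linear (phi : restr_scalars iota V -> restr_scalars iota W).
Proof.
move=> sigma_iota phi_semilin a u v.
(* [linear] leaves its second vector unscaled, hence the coefficient 1, which [sigma] preserves. *)
have := phi_semilin (iota a) 1 u v.
by rewrite sigma_iota rmorph1 !scale1r.
Qed.

Theorem theorem3p13 (F E : fieldType) (iota : {rmorphism F -> E})
    (g h : lieAlgType E) :
  conjugate_over iota g h ->
  lie_isomorphic (restr_scalars iota g) (restr_scalars iota h).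
Proof.
case=> sigma [[_ sigma_iota] [phi [phi_bij phi_semilin phi_lieb]]].
(* Same function as [phi], retyped so that the structures over [F] are inferred. *)
pose psi : restr_scalars iota g -> restr_scalars iota h := phi.
have psi_lin : linear psi by exact: semilinear_restr_linear sigma_iota phi_semilin.
pose psiM := GRing.isLinear.Build F _ _ _ psi psi_lin.
pose psiL : {linear restr_scalars iota g -> restr_scalars iota h} :=
  HB.pack psi psiM.
(* The restricted bracket unfolds to the original one, so [phi_bij] and [phi_lieb] apply by
   conversion. *)
by exists psiL; split.
Qed.
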